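(* Let $f \in L^2_{\rho}(D;\mathbb{V})$, $0 < \alpha \leq \beta < \infty$, $\{y_i\}_{i=1}^m \subseteq D$, and let $w : D \to \mathbb{R}$ be such that $w(y_i)$ is well defined and nonnegative for all $i$. Suppose that $$\alpha \|p\|^2_{L^2_{\rho}(D)} \leq \frac1m \sum_{i=1}^m w(y_i) |p(y_i)|^2 \leq \beta \|p\|^2_{L^2_{\rho}(D)}, \quad \forall p \in P_S .$$ Let $n_1,\ldots,n_m \in \mathbb{V}$ be such that $f(y_i)+n_i \in \mathbb{V}_h$ for all $i$. Then the weighted least-squares approximation $$\hat f \in \operatorname*{argmin}_{p \in P_{S;\mathbb{V}_h}} \left\{ \frac1m \sum_{i=1}^m w(y_i) \| f(y_i) + n_i - p(y_i)\|_{\mathbb{V}}^2 \right\}$$ is unique, and satisfies $$\|f - \hat f\|_{L^2_\rho(D;\mathbb{V})} \leq \inf_{p \in P_{S;\mathbb{V}}} \left\{ \|f-p\|_{L^2_\rho(D;\mathbb{V})} + \left(1 + \frac{1}{\sqrt\alpha}\right) \|f-p\|_{\mathrm{disc}} \right\} + \|f - \mathcal{P}_h(f)\|_{L^2_\rho(D;\mathbb{V})} + \frac{1}{\sqrt\alpha} \|e\|_{\ell^2([m];\mathbb{V})},$$ where $e = \frac{1}{\sqrt m} \left( \sqrt{w(y_i)}\, n_i \right)_{i=1}^m \in \mathbb{V}^m$.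
   Context: $(D,\mathcal{D},\rho)$ is a probability space and $\mathbb{V}$ is a separable Hilbert space over $\mathbb{C}$ with norm $\|\cdot\|_{\mathbb{V}}$. $L^2_\rho(D)$ is the space of complex-valued square-integrable functions on $D$, and $L^2_\rho(D;\mathbb{V})$ is the Lebesgue--Bochner space of $f : D \to \mathbb{V}$ with $\|f\|^2_{L^2_\rho(D;\mathbb{V})} = \int_D \|f(y)\|_{\mathbb{V}}^2\, d\rho(y) < \infty$. All functions involved are regarded as having well-defined values at the sample points. $\mathbb{V}_h \subseteq \mathbb{V}$ is a finite-dimensional subspace and $\mathcal{P}_h : \mathbb{V} \to \mathbb{V}_h$ is the orthogonal projection; for $f \in L^2_\rho(D;\mathbb{V})$, $(\mathcal{P}_h f)(y) = \mathcal{P}_h(f(y))$. $\{\phi_\iota : \iota \in \mathcal{I}\} \subset L^2_\rho(D)$ is a dictionary of functions, and $S \subseteq \mathcal{I}$ is a finite index set with $|S| \leq s$, where $m \geq s$. For a subspace $\mathbb{W} \subseteq \mathbb{V}$ (or $\mathbb{W}=\mathbb{C}$), $P_{S;\mathbb{W}} = \{ \sum_{\iota \in S} c_\iota \phi_\iota : c_\iota \in \mathbb{W} \}$, and $P_S = P_{S;\mathbb{C}}$. The discrete semi-norm is $\|g\|_{\mathrm{disc}} = \left( \frac1m \sum_{i=1}^m w(y_i) \|g(y_i)\|_{\mathbb{V}}^2 \right)^{1/2}$. Also $[m]=\{1,\ldots,m\}$ and $\|e\|_{\ell^2([m];\mathbb{V})} = \left( \sum_{i=1}^m \|e_i\|_{\mathbb{V}}^2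 \right)^{1/2}$. *)

(* Defs.v *)
From HB Require Import structures.
From mathcomp Require Import all_boot all_order all_algebra.
From mathcomp Require Import finmap complex.
From mathcomp Require Import all_classical all_reals all_analysis.

Set Implicit Arguments.
Unset Strict Implicit.
Unset Printing Implicit Defensive.

Import Order.TTheory GRing.Theory Num.Theory.
Import numFieldNormedType.Exports.

Local Open Scope classical_set_scope.
Local Open Scope ring_scope.

Section HilbertSpace.
Context {R : realType} {V : normedModType R[i]}.

(* In a normed module over R[i] the norm is a (real, nonnegative) element of
   R[i]; rnorm is the same norm as an element of R. *)
Definition rnorm (v : V) : R := complex.Re `|v|.

Definition inner_product_of_norm (ip : {dot V for Num.conj}) : Prop :=
  forall v, `|v| ^+ 2 = ip v v.

Definition separable_space : Prop := exists2 A : set V, countable A & dense A.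

Definition fin_dim_subspace (W : set V) : Prop :=
  [/\ W 0,
      (forall (a : R[i]) u v, W u -> W v -> W (a *: u + v)) &
      exists b : seq V,
        forall v, W v -> exists c : 'I_(size b) -> R[i],
          v = \sum_(k < size b) c k *: b`_k].

Definition orthogonal_projection (ip : {dot V for Num.conj}) (W : set V)
    (P : V -> V) : Prop :=
  forall v, W (P v) /\ forall u, W u -> ip (v - P v) u = 0.

Definition l2norm (m : nat) (e : 'I_m -> V) : R :=
  Num.sqrt (\sum_(k < m) rnorm (e k) ^+ 2).

End HilbertSpace.

Arguments separable_space {R} V.

(* Functions are kept as pointwise-defined representatives, so that they can be
   evaluated at sample points. For scalar functions take V := R[i]^o. *)
Section Bochner.
Context {R : realType} {d : measure_display} {D : measurableType d}.
Context {V : normedModType R[i]}.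
Variable rho : probability D R.

(* Almost everywhere limits of simple functions: f itself need not be measurable,
   but it agrees with a measurable function off a null set, and the integrals
   below (suprema over simple functions below the integrand) do not see null
   sets. *)
Definition strongly_measurable (f : D -> V) : Prop :=
  exists s : nat -> D -> V,
    [/\ forall k, finite_set (range (s k)),
        forall k v, measurable (s k @^-1` [set v]) &
        {ae rho, forall y, s ^~ y @ \oo --> f y}].

Definition L2 (f : D -> V) : Prop :=
  strongly_measurable f /\
  (\int[rho]_y ((rnorm (f y)) ^+ 2)%:E < +oo)%E.

Definition L2norm (f : D -> V) : R :=
  Num.sqrt (fine (\int[rho]_y ((rnorm (f y)) ^+ 2)%:E)%E).

End Bochner.

Section LeastSquares.
Context {R : realType} {D : Type} {V : normedModType R[i]}.

(* The space P_{S;W} spanned by the phi_i, i in S, with coefficients in W;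
   P_S is the case V := R[i]^o, W := setT. *)
Definition dict_span (I : choiceType) (phi : I -> D -> R[i]) (S : {fset I})
    (W : set V) : set (D -> V) :=
  [set p | exists2 c : I -> V, (forall i, i \in S -> W (c i)) &
           p = (fun z => \sum_(i <- S) phi i z *: c i)].

Definition disc_norm (m : nat) (w : D -> R) (y : 'I_m -> D) (g : D -> V) : R :=
  Num.sqrt (m%:R^-1 * \sum_(k < m) w (y k) * rnorm (g (y k)) ^+ 2).

Definition lsq_error (m : nat) (w : D -> R) (y : 'I_m -> D) (b : 'I_m -> V)
    (p : D -> V) : R :=
  m%:R^-1 * \sum_(k < m) w (y k) * rnorm (b k - p (y k)) ^+ 2.

End LeastSquares.

Definition argmin (R : realType) (T : Type) (A : set T) (F : T -> R) : set T :=
  [set p | A p /\ forall q, A q -> F p <= F q].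

(* Main.v *)
Require Import Defs.
From HB Require Import structures.
From mathcomp Require Import all_boot all_order all_algebra.
From mathcomp Require Import finmap complex.
From mathcomp Require Import all_classical all_reals all_analysis.
From mathcomp Require Import measurable_realfun ring lra.

Set Implicit Arguments.
Unset Strict Implicit.
Unset Printing Implicit Defensive.

Import Order.TTheory GRing.Theory Num.Theory.
Import numFieldNormedType.Exports.

Local Open Scope classical_set_scope.
Local Open Scope ring_scope.

(** Sampling a function at the y_k, scaling the k-th value by sqrt (w (y_k) / m),
    turns the discrete semi-norm into the l2 norm of a vector in V^m
    ([disc_norm_sample]) and the least-squares error into a squared l2 distance
    ([lsq_error_sample]).  The sampled dictionary space is a finite-dimensional
    subspace of V^m, so the data have an orthogonal projection onto it; by
    Pythagoras the minimizers are exactly the g in P_{S;Vh} whose samples are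
    that projection.

    The lower stability bound extends from scalar to Vh-valued elements of the
    span ([stability_vector]): in a Parseval frame (u_j) of Vh, both
    |p(z)|^2 = sum_j |<p(z), u_j>|^2 and its integral split into scalar problems,
    each coordinate <p, u_j> lying in P_S.  Two minimizers have equal samples, so
    their difference has L2 norm zero: this is uniqueness almost everywhere.

    For the error bound take p in P_{S;V}, let P be the projection onto Vh, and
    write f - g = (f - P f) + P (f - p) + (P p - g).  The second term is at most
    |f - p| because P is a contraction.  The third lies in P_{S;Vh}, so its norm
    is at most alpha^(-1/2) times that of its samples; since the samples of P p
    are their own projection, these samples are the projection of the samples of
    P p - (f + n) = P (p - f - n), the last equality because f(y_k) + n_k is in
    Vh.  Two contractions then bound them by |f - p|_disc + |e|.

    Two devices keep the supporting theory short.  Projections and Parseval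
    identities are obtained from lists o such that every vector x of the
    subspace satisfies x = sum_(u in o) <x, u> u; orthonormality is used only to
    construct such a list ([frame_exists]).  Both triangle inequalities, in
    l2 and in L2, come from (a + b)^2 <= (1 + t) a^2 + (1 + 1/t) b^2 by
    optimizing over t > 0 ([le_add_of_weighted]).  As square-integrable functions
    are only almost everywhere equal to measurable ones, their integrals are
    handled through the comparison [ge0_integral_le_ae], which assumes no
    measurability. *)

(** * Parseval frames for a Hermitian inner product *)
Section Frame.
Context {C : numClosedFieldType} {U : lmodType C} (ip : {dot U for Num.conj}).
Implicit Types (o b : seq U) (x y v : U).

(** The frame operator of the list [o].  When [o] is orthonormal it is the
    orthogonal projection onto the span of [o]; vectors fixed by it are those
    that [o] reconstructs from their inner products. *)
Definition frame o x : U := \sum_(u <- o) ip x u *: u.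

Lemma ip_suml {J : Type} (r : seq J) (c : J -> C) (g : J -> U) y :
  ip (\sum_(j <- r) c j *: g j) y = \sum_(j <- r) c j * ip (g j) y.
Proof.
by rewrite linear_sumlz; apply: eq_bigr => j _; rewrite linearZl_LR.
Qed.

Lemma ip_conj x y : (ip x y)^* = ip y x.
Proof. by rewrite [RHS]hermC expr0 mul1r. Qed.

Lemma ip_sumr {J : Type} (r : seq J) (c : J -> C) (g : J -> U) x :
  ip x (\sum_(j <- r) c j *: g j) = \sum_(j <- r) (c j)^* * ip x (g j).
Proof.
by rewrite linear_sumr; apply: eq_bigr => j _; rewrite linearZr_LR.
Qed.

Lemma frame_linear o : linear (frame o).
Proof.
move=> a x y; rewrite /frame scaler_sumr -big_split /=; apply: eq_bigr => u _.
by rewrite linearDl linearZl_LR /= scalerDl scalerA.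
Qed.
HB.instance Definition _ o :=
  GRing.isLinear.Build C U U _ (frame o) (frame_linear o).

(** The frame operator is self-adjoint for every list [o]; this is what makes
    reconstruction alone give orthogonality of residuals. *)
Lemma frame_adj o x y : ip (frame o x) y = ip x (frame o y).
Proof.
rewrite ip_suml ip_sumr; apply: eq_bigr => u _.
by rewrite ip_conj mulrC.
Qed.

Lemma frame_sub_orthogonal o x y : frame o y = y -> ip (x - frame o x) y = 0.
Proof. by move=> yo; rewrite linearBl /= frame_adj yo subrr. Qed.

Lemma frame_parseval o x : frame o x = x ->
  ip x x = \sum_(u <- o) `|ip x u| ^+ 2.
Proof.
move=> xo; rewrite -{1}xo ip_suml; apply: eq_bigr => u _.
by rewrite normCK ip_conj.
Qed.

Lemma frame_mem (W : set U) o x :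
  W 0 -> (forall a u v, W u -> W v -> W (a *: u + v)) ->
  (forall u, u \in o -> W u) -> W (frame o x).
Proof.
move=> W0 Wlin; rewrite /frame; elim: o => [|u o IHo] Wo; first by rewrite big_nil.
rewrite big_cons; apply: Wlin; first by apply: Wo; rewrite mem_head.
by apply: IHo => u' u'o; apply: Wo; rewrite inE u'o orbT.
Qed.

(** Gram-Schmidt.  Adding [v] to the list, the residual [v - frame o v] is
    orthogonal to everything reconstructed so far, so appending its
    normalization extends the reconstruction to [v] and disturbs nothing.  The
    members of [o] are included among the reconstructed vectors so that the
    induction can use this orthogonality for them, and later so that
    [frame o] is idempotent. *)
Lemma frame_exists (W : set U) (b : seq U) :
  W 0 -> (forall a u v, W u -> W v -> W (a *: u + v)) ->
  (forall x, x \in b -> W x) ->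
  exists2 o, (forall u, u \in o -> W u) & (forall x, x \in b ++ o -> frame o x = x).
Proof.
move=> W0 Wlin; elim: b => [|v b IH] Wb; first by exists [::].
have [x xb|o Wo bo] := IH; first by apply: Wb; rewrite inE xb orbT.
pose v' := v - frame o v.
have orth x : x \in b ++ o -> ip x v' = 0.
  by move=> /bo xo; rewrite -ip_conj frame_sub_orthogonal// conjC0.
have [v'0|v'N0] := eqVneq v' 0.
  exists o => // x; rewrite inE => /predU1P[->|]; last exact: bo.
  by apply/esym/eqP; rewrite -subr_eq0 -/v' v'0.
have v'gt0 : 0 < ip v' v' by exact: neq0_dnorm_gt0.
pose r := sqrtC (ip v' v').
have rN0 : r != 0 by rewrite sqrtC_eq0 gt_eqF.
have rV_conj : (r^-1)^* = r^-1.
  by apply: geC0_conj; rewrite invr_ge0 sqrtC_ge0 ltW.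
pose u0 := r^-1 *: v'.
(* the square root in the normalization disappears, as u0 enters twice *)
have u0E x : ip x u0 *: u0 = (ip x v' / ip v' v') *: v'.
  rewrite /u0 linearZr_LR /= scalerA rV_conj; congr (_ *: _).
  by rewrite mulrC mulrA -expr2 exprVn sqrtCK mulrC.
have frame_cons x : frame (u0 :: o) x = (ip x v' / ip v' v') *: v' + frame o x.
  by rewrite /frame big_cons u0E.
have ipvv' : ip v v' = ip v' v'.
  rewrite -{1}[v](subrK (frame o v)) linearDl /= -/v' [X in _ + X]ip_suml.
  rewrite [X in _ + X]big1_seq ?addr0// => u /andP[_ uo].
  by rewrite orth ?mulr0// mem_cat uo orbT.
have frame_v' : frame o v' = 0.
  rewrite /frame big1_seq// => u /andP[_ uo].
  by rewrite -ip_conj orth ?conjC0 ?scale0r// mem_cat uo orbT.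
have WZ a x : W x -> W (a *: x) by move=> Wx; rewrite -[_ *: _]addr0; exact: Wlin.
exists (u0 :: o) => [u|x].
  rewrite inE => /predU1P[->|]; last exact: Wo.
  apply: WZ; rewrite /v' addrC -scaleN1r; apply: (Wlin).
    exact: (frame_mem v W0 Wlin Wo).
  by apply: Wb; rewrite mem_head.
rewrite frame_cons mem_cat !inE => /orP[/predU1P[->|xb]|/predU1P[->|xo]].
- by rewrite ipvv' divff ?scale1r ?subrK// gt_eqF.
- by rewrite orth ?mul0r ?scale0r ?add0r ?bo// mem_cat xb.
- by rewrite linearZ /= frame_v' scaler0 addr0 linearZl_LR /= mulfK ?gt_eqF.
- by rewrite orth ?mul0r ?scale0r ?add0r ?bo// mem_cat xo orbT.
Qed.
Lemma frame_fix_sum o {J : eqType} (r : seq J) (c : J -> C) (g : J -> U) :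
  (forall j, j \in r -> frame o (g j) = g j) ->
  frame o (\sum_(j <- r) c j *: g j) = \sum_(j <- r) c j *: g j.
Proof.
move=> gfix; rewrite linear_sum big_seq [RHS]big_seq; apply: eq_bigr => j jr.
by rewrite linearZ /= gfix.
Qed.

Lemma pythagoras u v : ip u v = 0 -> ip (u + v) (u + v) = ip u u + ip v v.
Proof. by move=> uv; rewrite dnormD uv conjC0 !addr0. Qed.

(** [frame o x] is the best approximation of [x] among the vectors that [o]
    reconstructs. *)
Lemma frame_pythagoras o x y : (forall u, u \in o -> frame o u = u) ->
  frame o y = y ->
  ip (x - y) (x - y) =
  ip (x - frame o x) (x - frame o x) + ip (frame o x - y) (frame o x - y).
Proof.
move=> ofix yfix; rewrite -[x - y](subrKA (frame o x)) pythagoras//.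
by apply: frame_sub_orthogonal; rewrite linearB /= yfix frame_fix_sum.
Qed.
End Frame.

(** * The inner product and the norm of V^m *)
Section FunDot.
Context {C : numClosedFieldType} {V : lmodType C} (ip : {dot V for Num.conj}).
Context (m : nat).
Definition ip_fun (g h : 'I_m -> V) : C := \sum_k ip (g k) (h k).

Let ip_fun_bilinear : bilinear_for *%R (Num.conj \; *%R) ip_fun.
Proof.
split=> g a h1 h2; rewrite /ip_fun /= mulr_sumr -big_split /=; apply: eq_bigr => k _.
  by rewrite linearDl linearZl_LR.
by rewrite linearDr linearZr_LR.
Qed.
HB.instance Definition _ :=
  bilinear_isBilinear.Build C _ _ C *%R (Num.conj \; *%R) ip_fun ip_fun_bilinear.

Let ip_fun_herm g h : ip_fun g h = (-1) ^+ false * (ip_fun h g)^*.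
Proof.
rewrite expr0 mul1r rmorph_sum; apply: eq_bigr => k _.
exact/esym/ip_conj.
Qed.
HB.instance Definition _ :=
  isHermitianSesquilinear.Build C _ false Num.conj ip_fun ip_fun_herm.

Let ip_fun_gt0 g : g != 0 -> 0 < ip_fun g g.
Proof.
move=> gN0; rewrite lt_def sumr_ge0 ?andbT; last by move=> k _; exact: dnorm_ge0.
apply: contraNN gN0; rewrite psumr_eq0; last by move=> k _; exact: dnorm_ge0.
move=> /allP g0; apply/eqP/funext => k; apply/eqP.
by rewrite -(dnorm_eq0 ip); apply: g0; rewrite mem_index_enum.
Qed.
HB.instance Definition _ := isDotProduct.Build C _ ip_fun ip_fun_gt0.
End FunDot.

Section Rnorm.
Context {R : realType} {V : normedModType R[i]}.
Implicit Types (u v : V) (a : R[i]).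

Lemma norm_rnorm v : `|v| = (rnorm v)%:C%C.
Proof. by rewrite /rnorm RRe_real// normr_real. Qed.

Lemma rnorm_ge0 v : 0 <= rnorm v.
Proof. by rewrite -ler0c -norm_rnorm. Qed.

Lemma rnorm0 : rnorm (0 : V) = 0.
Proof. by rewrite /rnorm normr0. Qed.

Lemma rnorm0_eq0 v : rnorm v = 0 -> v = 0.
Proof. by move=> v0; apply/eqP; rewrite -normr_eq0 norm_rnorm v0. Qed.

Lemma rnormN v : rnorm (- v) = rnorm v.
Proof. by rewrite /rnorm normrN. Qed.

Lemma rnormB u v : rnorm (u - v) = rnorm (v - u).
Proof. by rewrite /rnorm distrC. Qed.

Lemma rnormD u v : rnorm (u + v) <= rnorm u + rnorm v.
Proof. by rewrite -lecR rmorphD /= -!norm_rnorm ler_normD. Qed.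

Lemma rnormZ a v : rnorm (a *: v) = rnorm (a : R[i]^o) * rnorm v.
Proof. by apply: complexI; rewrite rmorphM /= -!norm_rnorm normrZ. Qed.

Lemma rnorm_dist u v : `|rnorm u - rnorm v| <= rnorm (u - v).
Proof.
rewrite ler_norml; apply/andP; split.
  by rewrite lerNl opprB lerBlDr rnormB (le_trans _ (rnormD _ _))// subrK.
by rewrite lerBlDr (le_trans _ (rnormD _ _))// subrK.
Qed.

(** The norm of V takes values in R[i]; composing with the real part is
    continuous for the topology of R. *)
Lemma cvg_rnorm (u : nat -> V) v :
  u @ \oo --> v -> (fun k => rnorm (u k)) @ \oo --> rnorm v.
Proof.
move=> uv; apply/cvgrPdist_lt => e e0.
have e0C : 0 < e%:C%C by rewrite ltcR.
move/cvgrPdist_lt: uv => /(_ _ e0C); apply: filterS => k uk.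
by apply: (le_lt_trans (rnorm_dist _ _)); rewrite -ltcR -norm_rnorm.
Qed.

End Rnorm.

Section WeightedSquares.
Context {R : realType}.
Implicit Types a b t x y z : R.

Lemma sqrD_le_weighted a b t : 0 < t ->
  (a + b) ^+ 2 <= (1 + t) * a ^+ 2 + (1 + t^-1) * b ^+ 2.
Proof.
move=> t0; rewrite -subr_ge0.
have -> : (1 + t) * a ^+ 2 + (1 + t^-1) * b ^+ 2 - (a + b) ^+ 2 =
          (t * a - b) ^+ 2 / t by field; rewrite gt_eqF.
by rewrite divr_ge0 ?sqr_ge0// ltW.
Qed.

(** Minkowski's inequality in abstract form: [x], [y], [z] stand for the norms
    of two vectors and of their sum.  The optimal weight is t = y / x, which
    turns the right-hand side into (x + y)^2. *)
Lemma le_add_of_weighted x y z : 0 <= x -> 0 <= y -> 0 <= z ->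
  (forall t, 0 < t -> z ^+ 2 <= (1 + t) * x ^+ 2 + (1 + t^-1) * y ^+ 2) ->
  z <= x + y.
Proof.
move=> x0 y0 z0 H; apply/ler_addgt0Pr => e e0.
(* shifting x and y by e / 2 makes the optimal weight positive when x or y is 0 *)
have x'0 : 0 < x + e / 2 by lra.
have y'0 : 0 < y + e / 2 by lra.
have -> : x + y + e = (x + e / 2) + (y + e / 2) by field.
have s0 : 0 <= x + e / 2 + (y + e / 2) by rewrite ltW// addr_gt0.
rewrite -ler_sqr ?nnegrE//.
have t0 : 0 < (y + e / 2) / (x + e / 2) by rewrite divr_gt0.
apply: (le_trans (H _ t0)).
have -> : (x + e / 2 + (y + e / 2)) ^+ 2 =
    (1 + (y + e / 2) / (x + e / 2)) * (x + e / 2) ^+ 2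
    + (1 + ((y + e / 2) / (x + e / 2))^-1) * (y + e / 2) ^+ 2.
  by field; apply/andP; split; rewrite gt_eqF//; lra.
apply: lerD; apply: ler_wpM2l.
- by rewrite addr_ge0 ?ltW.
- by rewrite ler_sqr ?nnegrE; lra.
- by rewrite addr_ge0 ?invr_ge0 ?ltW.
- by rewrite ler_sqr ?nnegrE; lra.
Qed.
End WeightedSquares.

Section L2normFinite.
Context {R : realType} {V : normedModType R[i]} {m : nat}.
Implicit Types g h : 'I_m -> V.

Lemma l2norm_sqr g : l2norm g ^+ 2 = \sum_k rnorm (g k) ^+ 2.
Proof. by rewrite sqr_sqrtr// sumr_ge0// => k _; rewrite sqr_ge0. Qed.

Lemma l2normD g h : l2norm (g + h) <= l2norm g + l2norm h.
Proof.
apply: le_add_of_weighted; rewrite ?sqrtr_ge0// => t t0.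
rewrite !l2norm_sqr !mulr_sumr -big_split /=; apply: ler_sum => k _.
apply: le_trans (sqrD_le_weighted _ _ t0).
by rewrite ler_sqr ?nnegrE ?addr_ge0 ?rnorm_ge0 ?rnormD.
Qed.

Lemma ler_l2norm g h : (forall k, rnorm (g k) <= rnorm (h k)) -> l2norm g <= l2norm h.
Proof.
move=> gh; rewrite ler_wsqrtr// ler_sum// => k _.
by rewrite ler_sqr ?nnegrE ?rnorm_ge0.
Qed.

Lemma l2norm_ip (ip : {dot V for Num.conj}) g :
  inner_product_of_norm ip -> (l2norm g ^+ 2)%:C%C = ip_fun ip g g.
Proof.
move=> Vip; rewrite l2norm_sqr rmorph_sum; apply: eq_bigr => k _.
by rewrite rmorphXn /= -norm_rnorm Vip.
Qed.
End L2normFinite.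

(** * Integrals of nonnegative functions without measurability *)
Section NonmeasurableIntegral.
Context {R : realType} {d : measure_display} {D : measurableType d}.
Variable mu : {measure set D -> \bar R}.
Import HBNNSimple.

(** The integral of a nonnegative function is a supremum over the simple
    functions below it, and cutting such a simple function to zero on a null set
    changes neither its simplicity nor its integral. *)
Lemma ge0_integral_le_ae (F G : D -> \bar R) :
  (forall x, 0 <= F x)%E -> (forall x, 0 <= G x)%E ->
  {ae mu, forall x, F x <= G x}%E ->
  (\int[mu]_x F x <= \int[mu]_x G x)%E.
Proof.
move=> F0 G0 [N [mN N0 subN]].
rewrite !ge0_integralTE//; apply: ge_ereal_sup => _ [h /= hF <-].
have mNC : measurable (~` N) by exact: measurableC.
pose h' := proj_nnsfun h mNC.
apply: (@le_trans _ _ (sintegral mu h')); last first.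
  apply: ereal_sup_ubound; exists h' => // x.
  rewrite /h' /= mindicE; case: (pselect (N x)) => Nx.
    by rewrite memNset ?mulr0//; apply.
  rewrite mem_set// mulr1 (le_trans (hF x))//.
  by apply: contrapT => nFG; apply: Nx; apply: subN.
have sint (g : {nnsfun D >-> R}) : sintegral mu g = (\int[mu]_x (g x)%:E)%E.
  by rewrite integral_nnsfun// patch_setT.
rewrite !sint le_eqVlt; apply/orP; left; apply/eqP.
apply: ae_eq_integral => //.
- by apply/measurable_EFinP; exact: measurable_funTS.
- by apply/measurable_EFinP; exact: measurable_funTS.
exists N; split => // x /= nhh; apply: contrapT => Nx; apply: nhh => _.
by rewrite /h' /= mindicE mem_set// mulr1.
Qed.

Lemma ge0_integral_eq_ae (F G : D -> \bar R) :
  (forall x, 0 <= F x)%E -> (forall x, 0 <= G x)%E ->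
  {ae mu, forall x, F x = G x} ->
  (\int[mu]_x F x = \int[mu]_x G x)%E.
Proof.
move=> F0 G0 FG; apply/eqP; rewrite eq_le; apply/andP; split.
  by apply: ge0_integral_le_ae => //; apply: filterS FG => x ->.
by apply: ge0_integral_le_ae => //; apply: filterS FG => x ->.
Qed.

End NonmeasurableIntegral.

(** * Strong measurability *)
Section SimpleMaps.
Context {d : measure_display} {D : measurableType d}.

Definition simple_map {T : Type} (s : D -> T) :=
  finite_set (range s) /\ forall v, measurable (s @^-1` [set v]).

Lemma simple_map_preimage {T : Type} (s : D -> T) (B : set T) :
  simple_map s -> measurable (s @^-1` B).
Proof.
move=> [sfin smeas].
have -> : s @^-1` B = \bigcup_(v in range s `&` B) (s @^-1` [set v]).
  apply/seteqP; split=> [x Bx|x [v [_ Bv] sxv]]; last by rewrite /preimage /= sxv.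
  by exists (s x) => //; split => //; exists x.
by apply: fin_bigcup_measurable => //; exact: sub_finite_set sfin.
Qed.

Lemma simple_map_comp {T1 T2 : Type} (h : T1 -> T2) (s : D -> T1) :
  simple_map s -> simple_map (h \o s).
Proof.
move=> ss; split; last first.
  by move=> v; exact: (simple_map_preimage (h @^-1` [set v]) ss).
apply: sub_finite_set (finite_image h ss.1).
by move=> _ [x _ <-]; exists (s x) => //; exists x.
Qed.

Lemma simple_map_pair {T1 T2 : Type} (s1 : D -> T1) (s2 : D -> T2) :
  simple_map s1 -> simple_map s2 -> simple_map (fun x => (s1 x, s2 x)).
Proof.
move=> [fin1 m1] [fin2 m2]; split.
  apply: sub_finite_set (finite_setX fin1 fin2).
  by move=> _ [x _ <-]; split; exists x.
move=> [a b].
have -> : (fun x => (s1 x, s2 x)) @^-1` [set (a, b)] =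
          s1 @^-1` [set a] `&` s2 @^-1` [set b].
  by apply/seteqP; split=> x /= [-> ->].
exact: measurableI.
Qed.

Lemma simple_map_op {T1 T2 T3 : Type} (h : T1 -> T2 -> T3)
    (s1 : D -> T1) (s2 : D -> T2) :
  simple_map s1 -> simple_map s2 -> simple_map (fun x => h (s1 x) (s2 x)).
Proof.
move=> h1 h2; exact: (simple_map_comp (fun p => h p.1 p.2) (simple_map_pair h1 h2)).
Qed.

Lemma simple_map_cst {T : Type} (c : T) : simple_map (fun _ : D => c).
Proof.
split; first by apply: sub_finite_set (finite_set1 c) => _ [x _ <-].
move=> v; case: (pselect (c = v)) => [->|cv].
  by rewrite (_ : _ @^-1` _ = setT)//; apply/seteqP.
by rewrite (_ : _ @^-1` _ = set0)//; apply/seteqP; split => x //= /cv.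
Qed.

End SimpleMaps.

Section StronglyMeasurable.
Context {R : realType} {d : measure_display} {D : measurableType d}.
Variable rho : probability D R.

Lemma strongly_measurable_cst (V : normedModType R[i]) (c : V) :
  strongly_measurable rho (fun _ => c).
Proof.
exists (fun _ _ => c); split => [k|k v|].
- exact: (simple_map_cst c).1.
- exact: (simple_map_cst c).2.
- by apply: aeW => x; exact: cvg_cst.
Qed.

(** Sequential continuity of [h] is all that is needed, and it covers sums,
    scalings, opposites and the projection onto a subspace at once; a unary
    operation is the case where [h] ignores its second argument. *)
Lemma strongly_measurable_op (V1 V2 V3 : normedModType R[i])
    (h : V1 -> V2 -> V3) (f1 : D -> V1) (f2 : D -> V2) :
  (forall (u : nat -> V1) (v : nat -> V2) a b, u @ \oo --> a -> v @ \oo --> b ->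
     (fun k => h (u k) (v k)) @ \oo --> h a b) ->
  strongly_measurable rho f1 -> strongly_measurable rho f2 ->
  strongly_measurable rho (fun x => h (f1 x) (f2 x)).
Proof.
move=> hcont [s1 [fin1 m1 cvg1]] [s2 [fin2 m2 cvg2]].
have ss k : simple_map (fun x => h (s1 k x) (s2 k x)).
  by apply: simple_map_op; split.
exists (fun k x => h (s1 k x) (s2 k x)); split => [k|k v|].
- exact: (ss k).1.
- exact: (ss k).2.
- by apply: filterS2 cvg1 cvg2 => x; exact: hcont.
Qed.

(** Off the null set where the simple functions fail to converge, the norm of
    [f] is a pointwise limit of measurable functions; [g] is this limit,
    extended by 0. *)
Lemma rnorm_ae_measurable (V : normedModType R[i]) (f : D -> V) :
  strongly_measurable rho f ->
  exists g : D -> R, [/\ measurable_fun setT g, forall x, 0 <= g x &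
    {ae rho, forall x, rnorm (f x) = g x}].
Proof.
move=> [s [sfin smeas [N [mN N0 subN]]]].
have mNC : measurable (~` N) by exact: measurableC.
exists (fun x => rnorm (f x) * \1_(~` N) x); split.
- apply: (@measurable_fun_cvg _ _ _ _ (fun k x => rnorm (s k x) * \1_(~` N) x)).
    move=> k; apply: measurable_funM; last exact: measurable_indic.
    move=> _ B mB; rewrite setTI.
    by apply: (simple_map_preimage (s := s k) ((@rnorm R V) @^-1` B)); split.
  move=> x _; rewrite indicE; case: (pselect (N x)) => Nx.
    rewrite memNset; last by apply.
    by rewrite mulr0; under eq_fun do rewrite mulr0; exact: cvg_cst.
  rewrite mem_set// mulr1; under eq_fun do rewrite mulr1.
  by apply: cvg_rnorm; apply: contrapT => sf; apply: Nx; apply: subN.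
- by move=> x; rewrite mulr_ge0 ?rnorm_ge0.
exists N; split => // x /= nfg; apply: contrapT => Nx; apply: nfg.
by rewrite indicE mem_set// mulr1.
Qed.

End StronglyMeasurable.

(** * The space L2 of vector-valued functions *)
Section L2theory.
Context {R : realType} {d : measure_display} {D : measurableType d}.
Variable rho : probability D R.

(** The squared norm as an extended real, so that the inequality [L2sqD] also
    proves that sums are square-integrable. *)
Definition L2sq {V : normedModType R[i]} (f : D -> V) : \bar R :=
  (\int[rho]_x (rnorm (f x) ^+ 2)%:E)%E.

Section OneSpace.
Context {V : normedModType R[i]}.
Implicit Types f g : D -> V.

Lemma L2sq_ge0 f : (0 <= L2sq f)%E.
Proof. by apply: integral_ge0 => x _; rewrite lee_fin sqr_ge0. Qed.

Lemma L2norm_ge0 f : 0 <= L2norm rho f.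
Proof. exact: sqrtr_ge0. Qed.

Lemma L2sq_fin f : L2 rho f -> L2sq f = (L2norm rho f ^+ 2)%:E.
Proof.
move=> [_ fin]; rewrite sqr_sqrtr ?fine_ge0 ?L2sq_ge0//.
by rewrite fineK// ge0_fin_numE ?L2sq_ge0.
Qed.

Lemma L2sq_ae f (g : D -> R) : {ae rho, forall x, rnorm (f x) = g x} ->
  L2sq f = (\int[rho]_x (g x ^+ 2)%:E)%E.
Proof.
move=> fg; apply: ge0_integral_eq_ae => [x|x|]; rewrite ?lee_fin ?sqr_ge0//.
by apply: filterS fg => x ->.
Qed.

Lemma L2sqD f g t : 0 < t -> strongly_measurable rho f -> strongly_measurable rho g ->
  (L2sq (f + g)%R <= (1 + t)%:E * L2sq f + (1 + t^-1)%:E * L2sq g)%E.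
Proof.
move=> t0 /rnorm_ae_measurable [f' [mf' f'0 ff']].
move=> /rnorm_ae_measurable [g' [mg' g'0 gg']].
have t1 : 0 <= 1 + t by rewrite addr_ge0// ltW.
have t2 : 0 <= 1 + t^-1 by rewrite addr_ge0// invr_ge0 ltW.
rewrite (L2sq_ae ff') (L2sq_ae gg').
have mf2 : measurable_fun setT (fun x => (f' x ^+ 2)%:E).
  by apply/measurable_EFinP; exact: measurable_funX.
have mg2 : measurable_fun setT (fun x => (g' x ^+ 2)%:E).
  by apply/measurable_EFinP; exact: measurable_funX.
have f20 x : (0 <= (f' x ^+ 2)%:E)%E by rewrite lee_fin sqr_ge0.
have g20 x : (0 <= (g' x ^+ 2)%:E)%E by rewrite lee_fin sqr_ge0.
rewrite -!ge0_integralZl_EFin//.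
rewrite -ge0_integralD//; last 4 first.
- by move=> x _; rewrite mule_ge0.
- exact: measurable_funeM.
- by move=> x _; rewrite mule_ge0.
- exact: measurable_funeM.
apply: ge0_integral_le_ae => [x|x|].
- by rewrite lee_fin sqr_ge0.
- by rewrite adde_ge0// mule_ge0.
apply: filterS2 ff' gg' => x fx gx; rewrite -!EFinM -EFinD lee_fin.
apply: le_trans (sqrD_le_weighted _ _ t0).
rewrite ler_sqr ?nnegrE ?addr_ge0 ?rnorm_ge0//.
by rewrite -fx -gx; exact: rnormD.
Qed.

Lemma strongly_measurableD f g :
  strongly_measurable rho f -> strongly_measurable rho g ->
  strongly_measurable rho (f + g)%R.
Proof.
by apply: (strongly_measurable_op (h := fun a b : V => a + b)) => u v a b; exact: cvgD.
Qed.

Lemma L2D f g : L2 rho f -> L2 rho g -> L2 rho (f + g)%R.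
Proof.
move=> L2f L2g; split; first exact: strongly_measurableD L2f.1 L2g.1.
apply: le_lt_trans (L2sqD ltr01 L2f.1 L2g.1) _.
by rewrite (L2sq_fin L2f) (L2sq_fin L2g) -!EFinM -EFinD ltry.
Qed.

Lemma L2normD f g : L2 rho f -> L2 rho g ->
  L2norm rho (f + g)%R <= L2norm rho f + L2norm rho g.
Proof.
move=> L2f L2g; apply: le_add_of_weighted; rewrite ?L2norm_ge0// => t t0.
have := L2sqD t0 L2f.1 L2g.1.
by rewrite !L2sq_fin//; exact: L2D.
Qed.

Lemma L2_0 : L2 rho (0 : D -> V).
Proof.
split; first exact: strongly_measurable_cst.
rewrite integral0_eq// => x _.
by rewrite [(0 : D -> V) x]/(0 : V) rnorm0 expr0n.
Qed.

Lemma L2norm_eq0 f : L2 rho f -> L2norm rho f = 0 -> {ae rho, forall x, f x = 0}.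
Proof.
move=> L2f f0; have [g [mg g0 fg]] := rnorm_ae_measurable L2f.1.
have := L2sq_fin L2f; rewrite f0 expr0n /= (L2sq_ae fg) => int0.
have mg2 : measurable_fun setT (fun x => (g x ^+ 2)%:E).
  by apply/measurable_EFinP; exact: measurable_funX.
have g2ae : ae_eq rho setT (fun x => (g x ^+ 2)%:E) (cst 0%E).
  apply/ae_eq_integral_abs => //; rewrite -[RHS]int0.
  by apply: eq_integral => x _; rewrite gee0_abs// lee_fin sqr_ge0.
apply: filterS2 g2ae fg => x /(_ I) [gx] fx.
by apply: rnorm0_eq0; rewrite fx; apply/eqP; rewrite -sqrf_eq0; apply/eqP.
Qed.

End OneSpace.

Lemma L2_le {V1 V2 : normedModType R[i]} (f : D -> V1) (g : D -> V2) :
  strongly_measurable rho f -> L2 rho g -> (forall x, rnorm (f x) <= rnorm (g x)) ->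
  L2 rho f /\ L2norm rho f <= L2norm rho g.
Proof.
move=> mf L2g fg.
have fgsq : (L2sq f <= L2sq g)%E.
  apply: ge0_integral_le_ae => [x|x|]; rewrite ?lee_fin ?sqr_ge0//.
  by apply: aeW => x; rewrite lee_fin ler_sqr ?nnegrE ?rnorm_ge0.
have L2f : L2 rho f by split => //; exact: le_lt_trans fgsq L2g.2.
split => //; rewrite -ler_sqr ?nnegrE ?L2norm_ge0//.
by rewrite -lee_fin -!L2sq_fin.
Qed.

Lemma L2B {V : normedModType R[i]} (f g : D -> V) :
  L2 rho f -> L2 rho g -> L2 rho (f - g).
Proof.
move=> L2f L2g; apply: L2D => //.
have mNg : strongly_measurable rho (- g).
  apply: (strongly_measurable_op (h := fun a (_ : V) => - a)) L2g.1 L2g.1.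
  by move=> u _ a _ ua _; exact: cvgN.
suff Ng_le z : rnorm ((- g) z) <= rnorm (g z) by case: (L2_le mNg L2g Ng_le).
by rewrite -[leRHS]rnormN.
Qed.

Lemma L2_scale {V : normedModType R[i]} (g : D -> R[i]^o) (c : V) :
  L2 rho g -> L2 rho (fun x => g x *: c).
Proof.
move=> L2g; have mgc : strongly_measurable rho (fun x => g x *: c).
  apply: (strongly_measurable_op (h := fun (a : R[i]^o) (b : V) => a *: b)) L2g.1 _.
    by move=> u v a b; exact: cvgZ.
  exact: strongly_measurable_cst.
split => //.
have [g' [mg' g'0 gg']] := rnorm_ae_measurable L2g.1.
have -> : (\int[rho]_x (rnorm (g x *: c) ^+ 2)%:E =
           \int[rho]_x ((rnorm c ^+ 2)%:E * (g' x ^+ 2)%:E))%E.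
  apply: ge0_integral_eq_ae => [x|x|].
  - by rewrite lee_fin sqr_ge0.
  - by rewrite -EFinM lee_fin mulr_ge0 ?sqr_ge0.
  by apply: filterS gg' => x gx; rewrite rnormZ -gx exprMn mulrC.
rewrite ge0_integralZl_EFin ?sqr_ge0//; last 2 first.
- by move=> x _; rewrite lee_fin sqr_ge0.
- by apply/measurable_EFinP; exact: measurable_funX.
by rewrite -(L2sq_ae gg') (L2sq_fin L2g) -EFinM ltry.
Qed.

Lemma L2_sum {V : normedModType R[i]} {J : eqType} (r : seq J) (F : J -> D -> V) :
  (forall j, j \in r -> L2 rho (F j)) -> L2 rho (\sum_(j <- r) F j).
Proof.
move=> L2F; rewrite big_seq; elim/big_ind: _ => //.
- exact: L2_0.
- by move=> f g; exact: L2D.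
Qed.

(** Pythagoras integrated: a pointwise decomposition of the squared norm passes
    to L2. *)
Lemma L2norm_parseval {V1 V2 : normedModType R[i]} {J : Type} (r : seq J)
    (f : D -> V1) (g : J -> D -> V2) :
  L2 rho f -> (forall j, L2 rho (g j)) ->
  (forall x, rnorm (f x) ^+ 2 = \sum_(j <- r) rnorm (g j x) ^+ 2) ->
  L2norm rho f ^+ 2 = \sum_(j <- r) L2norm rho (g j) ^+ 2.
Proof.
move=> L2f L2g fg; apply: EFin_inj; rewrite -(L2sq_fin L2f) -sumEFin.
under [RHS]eq_bigr do rewrite -L2sq_fin//.
have /choice [g' g'P] j := rnorm_ae_measurable (L2g j).1.
under [RHS]eq_bigr => j _ do rewrite (L2sq_ae (let: And3 _ _ h := g'P j in h)).
rewrite -ge0_integral_sum//; last 2 first.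
- by move=> j; apply/measurable_EFinP; apply: measurable_funX; case: (g'P j).
- by move=> j x _; rewrite lee_fin sqr_ge0.
apply: ge0_integral_eq_ae => [x|x|].
- by rewrite lee_fin sqr_ge0.
- by rewrite sume_ge0// => j _; rewrite lee_fin sqr_ge0.
have gg' : {ae rho, forall x, \sum_(j <- r) rnorm (g j x) ^+ 2 = \sum_(j <- r) g' j x ^+ 2}.
  elim: r {fg} => [|j r IH]; first by apply: aeW => x; rewrite !big_nil.
  have [_ _ gj] := g'P j.
  by apply: filterS2 gj IH => x jx rx; rewrite !big_cons jx rx.
by apply: filterS gg' => x gx; rewrite sumEFin fg gx.
Qed.

End L2theory.

(** * Orthogonal projection onto a finite-dimensional subspace *)
Section OrthProj.
Context {R : realType} {V : normedModType R[i]} (ip : {dot V for Num.conj}).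
Hypothesis Vip : inner_product_of_norm ip.

Lemma rnorm_ip v : (rnorm v ^+ 2)%:C%C = ip v v.
Proof. by rewrite rmorphXn /= -norm_rnorm Vip. Qed.

Variables (W : set V) (P : V -> V).
Hypothesis Wlin : forall a u v, W u -> W v -> W (a *: u + v).
Hypothesis PW : orthogonal_projection ip W P.

Lemma orthproj_unique v a : W a -> (forall u, W u -> ip (v - a) u = 0) -> a = P v.
Proof.
move=> Wa aP; have [WPv vP] := PW v.
have WB : W (P v - a) by rewrite addrC -scaleN1r; exact: Wlin.
apply/esym/eqP; rewrite -subr_eq0 -(dnorm_eq0 ip).
have {1}-> : P v - a = (v - a) - (v - P v) by rewrite opprB [RHS]addrC subrKA.
by rewrite linearBl /= aP// vP// subrr.
Qed.

Lemma orthproj_id v : W v -> P v = v.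
Proof.
by move=> Wv; apply/esym/orthproj_unique => // u _; rewrite subrr linear0l.
Qed.

Lemma orthproj_linear : linear P.
Proof.
move=> a u v; apply/esym/orthproj_unique.
  by apply: Wlin; [case: (PW u)|case: (PW v)].
move=> t Wt; rewrite opprD addrACA -scalerBr linearDl linearZl_LR /=.
by rewrite (PW u).2// (PW v).2// mulr0 addr0.
Qed.

Lemma orthprojB u v : P (u - v) = P u - P v.
Proof. by rewrite addrC -scaleN1r orthproj_linear scaleN1r addrC. Qed.

Lemma orthproj_contract v : rnorm (P v) <= rnorm v.
Proof.
have [WPv vP] := PW v.
rewrite -ler_sqr ?nnegrE ?rnorm_ge0// -lecR !rnorm_ip.
rewrite -[in leRHS](subrK (P v) v) pythagoras; last exact: vP.
by rewrite lerDr dnorm_ge0.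
Qed.

Lemma orthproj_cvg (u : nat -> V) v : u @ \oo --> v -> (fun k => P (u k)) @ \oo --> P v.
Proof.
move=> uv; apply/cvgrPdist_lt => e e0.
move/cvgrPdist_lt: uv => /(_ _ e0); apply: filterS => k uk.
apply: le_lt_trans uk; rewrite -orthprojB !norm_rnorm lecR.
exact: orthproj_contract.
Qed.

(** The vectors that span [W] need not lie in [W], so Gram-Schmidt is applied to
    their projections, which lie in [W] and still span it. *)
Lemma fin_dim_frame : fin_dim_subspace W ->
  exists2 o, (forall u, u \in o -> W u) & (forall v, W v -> frame ip o v = v).
Proof.
move=> [W0 _ [b bP]].
have [x|o Wo bo] := @frame_exists _ _ ip W (map P b) W0 Wlin.
  by move=> /mapP[v _ ->]; case: (PW v).
exists o => // v Wv; rewrite -(orthproj_id Wv).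
have [c ->] := bP v Wv.
have Plin : P (\sum_k c k *: b`_k) = \sum_k c k *: P b`_k.
  elim/big_rec2: _ => [|k x y _ <-]; last by rewrite orthproj_linear.
  exact: orthproj_id.
rewrite Plin frame_fix_sum// => k _; apply: bo.
by rewrite mem_cat map_f ?mem_nth.
Qed.

Lemma orthproj_L2 {d : measure_display} {D : measurableType d} (rho : probability D R)
  (f : D -> V) : L2 rho f -> L2 rho (P \o f) /\ L2norm rho (P \o f) <= L2norm rho f.
Proof.
move=> L2f; apply: L2_le => // [|x]; last exact: orthproj_contract.
apply: (strongly_measurable_op (h := fun a (_ : V) => P a)) L2f.1 L2f.1.
by move=> u _ a _ ua _; exact: orthproj_cvg.
Qed.
End OrthProj.

(** * Sampling the dictionary space *)
Section WeightedSampling.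
Context {R : realType} {m : nat} (w : 'I_m -> R).

Definition wscale {V : normedModType R[i]} (v : 'I_m -> V) : 'I_m -> V :=
  fun k => ((Num.sqrt m%:R)^-1 * Num.sqrt (w k))%:C%C *: v k.

Lemma wscale_linear {V : normedModType R[i]} : linear (@wscale V).
Proof.
move=> a u v; apply/funext => k.
rewrite /wscale [in LHS]/GRing.add /= scalerDr; congr (_ + _).
by rewrite scalerA mulrC -scalerA.
Qed.
HB.instance Definition _ {V : normedModType R[i]} :=
  GRing.isLinear.Build R[i] ('I_m -> V) ('I_m -> V) _ (@wscale V) wscale_linear.

Hypothesis w_ge0 : forall k, 0 <= w k.

Lemma l2norm_wscale {V : normedModType R[i]} (v : 'I_m -> V) :
  l2norm (wscale v) ^+ 2 = m%:R^-1 * \sum_k w k * rnorm (v k) ^+ 2.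
Proof.
rewrite l2norm_sqr mulr_sumr; apply: eq_bigr => k _.
rewrite /wscale rnormZ.
have -> : rnorm (((Num.sqrt m%:R)^-1 * Num.sqrt (w k))%:C%C : R[i]^o) =
          (Num.sqrt m%:R)^-1 * Num.sqrt (w k).
  by rewrite /rnorm ger0_norm ?ler0c ?mulr_ge0 ?invr_ge0 ?sqrtr_ge0.
by rewrite !exprMn exprVn !sqr_sqrtr ?ler0n// -mulrA.
Qed.
End WeightedSampling.

Section DictSpan.
Context {R : realType} {D : Type} {V : normedModType R[i]}.
Context {I : choiceType} (phi : I -> D -> R[i]) (S : {fset I}).

Lemma dict_span0 (W : set V) : W 0 -> dict_span phi S W (0 : D -> V).
Proof.
move=> W0; exists (fun=> 0) => //; apply/funext => z.
by rewrite big1// => i _; rewrite scaler0.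
Qed.

Lemma dict_span_linear (W : set V) :
  (forall a u v, W u -> W v -> W (a *: u + v)) ->
  forall a p q, dict_span phi S W p -> dict_span phi S W q ->
    dict_span phi S W (a *: p + q).
Proof.
move=> Wlin a p q [c Wc ->] [c' Wc' ->].
exists (fun i => a *: c i + c' i) => [i iS|]; first exact: Wlin (Wc _ iS) (Wc' _ iS).
apply/funext => z; rewrite [LHS]/GRing.add /= [X in X + _]/GRing.scale /=.
rewrite scaler_sumr -big_split /=; apply: eq_bigr => i _.
by rewrite scalerDr !scalerA mulrC.
Qed.

(** Taking the inner product with a fixed vector reduces a vector-valued element
    of the span to a scalar one. *)
Lemma dict_span_coord (ip : {dot V for Num.conj}) (W : set V) p u :
  dict_span phi S W p ->
  dict_span phi S setT (fun z => ip (p z) u : R[i]^o).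
Proof.
move=> [c _ ->]; exists (fun i => ip (c i) u) => //.
by apply/funext => z; rewrite ip_suml.
Qed.

Lemma dict_span_map (W W' : set V) (P : V -> V) p : linear P ->
  (forall v, W v -> W' (P v)) -> dict_span phi S W p -> dict_span phi S W' (P \o p).
Proof.
move=> Plin PW [c Wc ->]; exists (P \o c) => [i iS|]; first exact/PW/Wc.
apply/funext => z /=; elim/big_rec2: _ => [|i x y _ <-]; last by rewrite Plin.
by have := Plin (-1) 0 0; rewrite scaler0 addr0 scaleN1r addNr.
Qed.
End DictSpan.

Lemma dict_span_L2 {R : realType} {d : measure_display} {D : measurableType d}
  (rho : probability D R) {V : normedModType R[i]}
  {I : choiceType} (phi : I -> D -> R[i]) (S : {fset I}) (W : set V) p :
  (forall i, L2 (V := R[i]^o) rho (phi i)) -> dict_span phi S W p -> L2 rho p.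
Proof.
move=> phi_L2 [c _ ->].
have -> : (fun z => \sum_(i <- S) phi i z *: c i) = \sum_(i <- S) (fun z => phi i z *: c i).
  by rewrite fct_sumE.
by apply: L2_sum => i _; exact: L2_scale.
Qed.

Section Sample.
Context {R : realType} {D : Type} {m : nat} (w : D -> R) (y : 'I_m -> D).

Definition sample {T : normedModType R[i]} (p : D -> T) : 'I_m -> T :=
  wscale (w \o y) (p \o y).

Lemma sample_linear {T : normedModType R[i]} : linear (@sample T).
Proof. by move=> a p q; rewrite /sample -linearP. Qed.
HB.instance Definition _ {T : normedModType R[i]} :=
  GRing.isLinear.Build R[i] (D -> T) ('I_m -> T) _ (@sample T) sample_linear.
End Sample.

Section LeastSquares.
Context {R : realType} {V : normedModType R[i]} (ip : {dot V for Num.conj}).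
Hypothesis Vip : inner_product_of_norm ip.
Context {d : measure_display} {D : measurableType d} (rho : probability D R).
Context {I : choiceType} (phi : I -> D -> R[i]) (S : {fset I}).
Hypothesis phi_L2 : forall i, L2 (V := R[i]^o) rho (phi i).
Variables (W : set V) (P : V -> V).
Hypothesis W_fin : fin_dim_subspace W.
Hypothesis P_proj : orthogonal_projection ip W P.
Context {m : nat} (w : D -> R) (y : 'I_m -> D).
Hypothesis w_ge0 : forall k, 0 <= w (y k).

Let W0 : W 0. Proof. by case: W_fin. Qed.
Let Wlin a u v : W u -> W v -> W (a *: u + v).
Proof. by case: W_fin => _ + _; exact. Qed.

Lemma l2norm_sample {T : normedModType R[i]} (p : D -> T) :
  l2norm (sample w y p) ^+ 2 = m%:R^-1 * \sum_k w (y k) * rnorm (p (y k)) ^+ 2.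
Proof. exact: l2norm_wscale. Qed.

Lemma disc_norm_sample {T : normedModType R[i]} (p : D -> T) :
  disc_norm w y p = l2norm (sample w y p).
Proof. by rewrite /disc_norm -l2norm_sample sqrtr_sqr ger0_norm ?sqrtr_ge0. Qed.

Lemma lsq_error_sample {T : normedModType R[i]} (b : 'I_m -> T) p :
  lsq_error w y b p = l2norm (wscale (w \o y) b - sample w y p) ^+ 2.
Proof. by rewrite -[wscale _ b - _](linearB (@wscale _ _ (w \o y) T)) l2norm_wscale. Qed.

(** In a Parseval frame of [W] both sides are sums over the coordinates, to each
    of which the scalar bound applies. *)
Lemma stability_vector (alpha : R) p :
  (forall q : D -> R[i]^o, dict_span phi S setT q ->
     alpha * L2norm rho q ^+ 2 <= l2norm (sample w y q) ^+ 2) ->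
  dict_span phi S W p ->
  alpha * L2norm rho p ^+ 2 <= l2norm (sample w y p) ^+ 2.
Proof.
move=> stab Sp; have [fr Wfr frW] := fin_dim_frame Wlin P_proj W_fin.
have Wp z : W (p z).
  case: Sp => c Wc ->; rewrite big_seq; elim/big_ind: _ => //.
    by move=> u v Wu Wv; rewrite -[u]scale1r; exact: Wlin.
  by move=> i iS; rewrite -[_ *: _]addr0; apply: Wlin => //; exact: Wc.
pose q u : D -> R[i]^o := fun z => ip (p z) u.
have Sq u : dict_span phi S setT (q u) by exact: dict_span_coord Sp.
have pq z : rnorm (p z) ^+ 2 = \sum_(u <- fr) rnorm (q u z) ^+ 2.
  apply: complexI; rewrite (rnorm_ip Vip) (frame_parseval (frW _ (Wp z))).
  rewrite rmorph_sum; apply: eq_bigr => u _.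
  by rewrite rmorphXn /= -norm_rnorm.
rewrite (L2norm_parseval (dict_span_L2 phi_L2 Sp) _ pq); last first.
  by move=> u; exact: dict_span_L2 phi_L2 (Sq u).
rewrite l2norm_sample mulr_sumr.
apply: (le_trans (ler_sum _ (fun u _ => stab _ (Sq u)))).
under eq_bigr do rewrite l2norm_sample.
rewrite -mulr_sumr exchange_big /= le_eqVlt; apply/orP; left; apply/eqP.
by congr (_ * _); apply: eq_bigr => k _; rewrite pq mulr_sumr.
Qed.

(** The frame operator of [o] is the orthogonal projection of V^m onto the
    sampled span: its values are samples of elements of the span, and it fixes
    all such samples.  The span is generated by the finitely many products
    phi_i * u with [u] in a frame of [W]. *)
Lemma sample_frame : exists o : seq ('I_m -> V),
  [/\ forall x, exists2 p, dict_span phi S W p &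
        sample w y p = frame (ip_fun ip (m:=m)) o x,
      forall x, x \in o -> frame (ip_fun ip (m:=m)) o x = x &
      forall p, dict_span phi S W p ->
        frame (ip_fun ip (m:=m)) o (sample w y p) = sample w y p].
Proof.
have [fr Wfr frW] := fin_dim_frame Wlin P_proj W_fin.
pose SW : set ('I_m -> V) := sample w y @` dict_span phi S W.
have SW0 : SW 0.
  by exists 0; [exact: dict_span0|exact: linear0].
have SWlin a u v : SW u -> SW v -> SW (a *: u + v).
  move=> [p Sp <-] [q Sq <-]; exists (a *: p + q); first exact: dict_span_linear.
  exact: linearP.
pose gen i u : D -> V := fun z => phi i z *: u.
pose b := [seq sample w y (gen i u) | i <- (S : seq I), u <- fr].
have [x /allpairsP[[i u] /= [iS uo ->]]|fr' Sfr' bfr'] :=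
    @frame_exists _ _ (ip_fun ip (m:=m)) SW b SW0 SWlin.
  exists (gen i u) => //; exists (fun j => if j == i then u else 0).
    by move=> j _; case: ifP => // _; exact: Wfr.
  apply/funext => z; rewrite (big_fsetD1 i)//= eqxx [X in _ + X]big1_fset ?addr0//.
  move=> j; rewrite in_fsetD1 => /andP[/negPf -> _] _; exact: scaler0.
have ofix x : x \in fr' -> frame (ip_fun ip (m:=m)) fr' x = x.
  by move=> xo; apply: bfr'; rewrite mem_cat xo orbT.
exists fr'; split => //.
  by move=> x; have [p Sp px] := frame_mem (ip_fun ip (m:=m)) x SW0 SWlin Sfr'; exists p.
move=> p [c Wc ->].
have -> : sample w y (fun z => \sum_(i <- S) phi i z *: c i) =
  \sum_(i <- S) \sum_(u <- fr) ip (c i) u *: sample w y (gen i u).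
  have -> : (fun z => \sum_(i <- S) phi i z *: c i) =
      \sum_(i <- S) \sum_(u <- fr) ip (c i) u *: gen i u.
    rewrite fct_sumE; apply/funext => z; rewrite big_seq [RHS]big_seq.
    apply: eq_bigr => i iS; rewrite fct_sumE -[c i in LHS](frW _ (Wc _ iS)).
    rewrite scaler_sumr; apply: eq_bigr => u _.
    by rewrite [RHS]/GRing.scale /= !scalerA mulrC.
  rewrite linear_sum; apply: eq_bigr => i _; rewrite linear_sum.
  by apply: eq_bigr => u _; rewrite linearZ.
rewrite linear_sum big_seq [RHS]big_seq; apply: eq_bigr => i iS.
rewrite big_seq; elim/big_ind: _ => [|x x' xf x'f|u ufr]; first exact: linear0.
  by rewrite linearD /= xf x'f.
rewrite linearZ /= bfr'// mem_cat; apply/orP; left.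
by apply/allpairsP; exists (i, u); split.
Qed.

End LeastSquares.

(** * The least-squares error bound *)
Theorem theorem1 (R : realType)
  (d : measure_display) (D : measurableType d) (rho : probability D R)
  (V : completeNormedModType R[i]) (ip : {dot V for Num.conj})
  (Vip : inner_product_of_norm ip) (Vsep : separable_space V)
  (Vh : set V) (Vh_fin : fin_dim_subspace Vh)
  (Ph : V -> V) (Ph_proj : orthogonal_projection ip Vh Ph)
  (I : choiceType) (phi : I -> D -> R[i])
  (phi_L2 : forall i, L2 (V := R[i]^o) rho (phi i))
  (s m : nat) (S : {fset I}) (card_S : (#|` S| <= s)%N) (le_sm : (s <= m)%N)
  (m_gt0 : (0 < m)%N)
  (f : D -> V) (f_L2 : L2 rho f)
  (alpha beta : R) (alpha_gt0 : 0 < alpha) (le_alpha_beta : alpha <= beta)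
  (y : 'I_m -> D) (w : D -> R) (w_ge0 : forall k, 0 <= w (y k))
  (stability : forall p : D -> R[i]^o, dict_span phi S setT p ->
     alpha * L2norm rho p ^+ 2
       <= m%:R^-1 * (\sum_(k < m) w (y k) * rnorm (p (y k)) ^+ 2)
       <= beta * L2norm rho p ^+ 2)
  (n : 'I_m -> V) (fn_Vh : forall k, Vh (f (y k) + n k)) :
  let minimizers := argmin (dict_span phi S Vh)
                      (lsq_error w y (fun k => f (y k) + n k)) in
  let e := fun k => ((Num.sqrt m%:R)^-1 * Num.sqrt (w (y k)))%:C%C *: n k in
  [/\ exists fhat, minimizers fhat,
      forall g1 g2, minimizers g1 -> minimizers g2 ->
        {ae rho, forall z, g1 z = g2 z} &
      forall fhat, minimizers fhat ->
        L2norm rho (f \- fhat) <=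
          inf [set L2norm rho (f \- p)
                   + (1 + (Num.sqrt alpha)^-1) * disc_norm w y (f \- p)
              | p in dict_span phi S setT]
          + L2norm rho (f \- (Ph \o f))
          + (Num.sqrt alpha)^-1 * l2norm e].
Proof.
move=> minimizers e.
have Vlin a u v : Vh u -> Vh v -> Vh (a *: u + v) by case: Vh_fin => _ + _; exact.
have SB p q : dict_span phi S Vh p -> dict_span phi S Vh q ->
    dict_span phi S Vh (p - q).
  by move=> Sp Sq; rewrite addrC -scaleN1r; exact: dict_span_linear.
have SL2 (W : set V) p : dict_span phi S W p -> L2 rho p by exact: dict_span_L2.
have PL := orthproj_linear Vlin Ph_proj.
have stab p : dict_span phi S Vh p ->
    alpha * L2norm rho p ^+ 2 <= l2norm (sample w y p) ^+ 2.
  apply: (stability_vector Vip phi_L2 Vh_fin Ph_proj) => // q Sq.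
  by rewrite l2norm_sample//; case/andP: (stability q Sq).
have alpha_sqrt : 0 < Num.sqrt alpha by rewrite sqrtr_gt0.
have l2_ge0 (g : 'I_m -> V) : 0 <= l2norm g by exact: sqrtr_ge0.
have L2_le_disc p : dict_span phi S Vh p ->
    L2norm rho p <= (Num.sqrt alpha)^-1 * l2norm (sample w y p).
  move=> Sp; rewrite ler_pdivlMl// -ler_sqr ?nnegrE ?mulr_ge0 ?L2norm_ge0 ?(ltW alpha_sqrt)//.
  by rewrite exprMn sqr_sqrtr ?stab// ltW.
pose data := wscale (w \o y) (fun k => f (y k) + n k).
have [fr [fr_span fr_fix fr_sample]] := sample_frame phi S Vh_fin Ph_proj w y.
pose proj := frame (ip_fun ip (m:=m)) fr.
have pyth x q : proj q = q ->
    l2norm (x - q) ^+ 2 = l2norm (x - proj x) ^+ 2 + l2norm (proj x - q) ^+ 2.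
  move=> qfix; apply: complexI; rewrite rmorphD /= !(l2norm_ip _ Vip).
  exact: frame_pythagoras.
have [p0 Sp0 p0E] := fr_span data.
have errE p : lsq_error w y (fun k => f (y k) + n k) p = l2norm (data - sample w y p) ^+ 2.
  exact: lsq_error_sample.
(* p0 attains the distance from the data to the sampled span, so for another
   minimizer the second term of the Pythagorean identity vanishes *)
have min_sample g : minimizers g -> sample w y g = proj data.
  move=> [Sg /(_ p0 Sp0)]; rewrite !errE p0E (pyth _ (sample w y g)); last exact: fr_sample.
  rewrite gerDl => g0; apply/esym/eqP; rewrite -subr_eq0; apply/eqP/funext => k.
  apply: rnorm0_eq0; apply/eqP; rewrite -sqrf_eq0.
  have /psumr_eq0P : \sum_k rnorm ((proj data - sample w y g) k) ^+ 2 = 0.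
    by apply/eqP; rewrite eq_le -l2norm_sqr g0 sqr_ge0.
  by move=> ->// k' _; exact: sqr_ge0.
split.
- exists p0; split => // q Sq; rewrite !errE p0E (pyth _ (sample w y q)); last exact: fr_sample.
  by rewrite lerDl sqr_ge0.
- move=> g1 g2 min1 min2; have S12 : dict_span phi S Vh (g1 - g2).
    by apply: SB; [exact: min1.1|exact: min2.1].
  have : L2norm rho (g1 - g2) = 0.
    apply/eqP; rewrite eq_le L2norm_ge0 andbT (le_trans (L2_le_disc _ S12))//.
    rewrite linearB /= !min_sample// subrr.
    have -> : l2norm (0 : 'I_m -> V) = 0.
      by rewrite /l2norm big1 ?sqrtr0// => k _; rewrite rnorm0 expr0n.
    by rewrite mulr0.
  move/(L2norm_eq0 (SL2 _ _ S12)); apply: filterS => z g12; apply/eqP.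
  by rewrite -subr_eq0; apply/eqP.
move=> g gmin; have [Sg _] := gmin.
rewrite -addrA -lerBlDr; apply: lb_le_inf.
  exists (L2norm rho (f \- 0) + (1 + (Num.sqrt alpha)^-1) * disc_norm w y (f \- 0)).
  by exists 0 => //; exact: dict_span0.
move=> _ [p Sp <-]; rewrite lerBlDr.
(* P p replaces p, as only elements of P_{S;Vh} are comparable with g *)
have SPp : dict_span phi S Vh (Ph \o p).
  by apply: dict_span_map Sp => // v _; case: (Ph_proj v).
have L2p := SL2 _ _ Sp.
have [L2Pf _] := orthproj_L2 Vip Vlin Ph_proj f_L2.
have [_ Pfp_le] := orthproj_L2 Vip Vlin Ph_proj (L2B f_L2 L2p).
have PfpE : (Ph \o (f - p)) = (Ph \o f) - (Ph \o p).
  by apply/funext => z; exact: (orthprojB Vlin Ph_proj).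
have sample_le : l2norm (sample w y ((Ph \o p) - g)) <= disc_norm w y (f \- p) + l2norm e.
  have -> : sample w y ((Ph \o p) - g) = proj (sample w y (Ph \o p) - data).
    rewrite linearB /= (min_sample g)// /proj linearB /=.
    by rewrite fr_sample.
  have proj_le x : l2norm (proj x) <= l2norm x.
    rewrite -ler_sqr ?nnegrE// -[in leRHS](subr0 x) (pyth x 0); last exact: linear0.
    by rewrite subr0 lerDr sqr_ge0.
  apply: (le_trans (proj_le _)).
  have -> : sample w y (Ph \o p) - data =
      wscale (w \o y) (fun k => Ph (p (y k) - (f (y k) + n k))).
    rewrite /data /sample -linearB; congr wscale; apply/funext => k.
    by rewrite (orthprojB Vlin Ph_proj) (orthproj_id Vlin Ph_proj (fn_Vh k)).
  apply: (@le_trans _ _ (l2norm (sample w y (f \- p) + e))).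
    have -> : sample w y (f \- p) + e =
        wscale (w \o y) (fun k => (f (y k) + n k) - p (y k)).
      rewrite -[e]/(wscale (w \o y) n) /sample -linearD; congr wscale.
      by apply/funext => k; rewrite addrAC.
    apply: ler_l2norm => k; rewrite /wscale !rnormZ ler_wpM2l ?rnorm_ge0//.
    by rewrite [leRHS]rnormB; exact: (orthproj_contract Vip Ph_proj).
  by rewrite (disc_norm_sample w_ge0) l2normD.
have fgE : f \- g = (f - (Ph \o f)) + ((Ph \o (f - p)) + ((Ph \o p) - g)).
  by rewrite PfpE subrKA subrKA.
rewrite fgE.
apply: le_trans (L2normD (L2B f_L2 L2Pf) _) _.
  by rewrite PfpE; apply: L2D; apply: L2B => //; [exact: SL2 SPp|exact: SL2 SPp|exact: SL2 Sg].
have step1 : L2norm rho ((Ph \o (f - p)) + ((Ph \o p) - g)) <=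
    L2norm rho (f - p) + (Num.sqrt alpha)^-1 * (disc_norm w y (f \- p) + l2norm e).
  apply: le_trans (L2normD _ _) _.
  - by rewrite PfpE; apply: L2B => //; exact: SL2 SPp.
  - by apply: L2B; [exact: SL2 SPp|exact: SL2 Sg].
  apply: lerD => //; apply: le_trans (L2_le_disc _ (SB _ _ SPp Sg)) _.
  by rewrite ler_wpM2l ?invr_ge0 ?(ltW alpha_sqrt).
have disc0 : 0 <= disc_norm w y (f \- p) by exact: sqrtr_ge0.
rewrite -[f \- p]/(f - p) -[f \- (Ph \o f)]/(f - (Ph \o f)) in disc0 step1 *.
lra.
Qed.
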